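(* For every integer $n \ge 1$ there exists a polycyclic group $G_n$ of torsion length $n$, i.e. $\mathrm{TorLen}(G_n)=n$.
   Context: For a group $G$, the torsion subgroup $\mathrm{Tor}(G)$ is the (normal) subgroup of $G$ generated by all elements of finite order of $G$. Set $G^{(0)}=G$ and $G^{(i+1)}=G^{(i)}/\mathrm{Tor}(G^{(i)})$ for $i \ge 0$ (these are iterated torsion quotients, not derived subgroups). The torsion length $\mathrm{TorLen}(G)$ is the smallest integer $i \ge 0$ such that $G^{(i)}$ is torsion-free (the trivial group counts as torsion-free); if no such $i$ exists then $\mathrm{TorLen}(G)=\omega$. *)

(* Defs.v *)
From HB Require Import structures.
From mathcomp Require Import all_boot generic_quotient.
From mathcomp Require Import boolp classical_sets.

Set Implicit Arguments.
Unset Strict Implicit.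
Unset Printing Implicit Defensive.

Local Open Scope quotient_scope.
Local Open Scope classical_set_scope.
Local Open Scope group_scope.

(* Groups are [groupType]s, possibly infinite; the subgroups of [G] are the   *)
(* bundled predicates [groupClosed G].                                        *)

Section Generated.
Variables (G : groupType) (A : set G).

Definition gen : {pred G} :=
  fun x =>
    `[< forall H : groupClosed G, (forall a, A a -> a \in H) -> x \in H >].

Fact gen1 : 1 \in gen.
Proof. by apply/asboolP => H _; exact: gpred1. Qed.

Fact genM : mulg_closed gen.
Proof.
move=> x y /asboolP Hx /asboolP Hy; apply/asboolP => H AH.
by apply: gpredM; [exact: Hx | exact: Hy].
Qed.

Fact genV : invg_closed gen.
Proof. by move=> x /asboolP Hx; apply/asboolP => H AH; apply/gpredVr/Hx. Qed.

HB.instance Definition _ := isMulClosed.Build G gen genM.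
HB.instance Definition _ := isMul1Closed.Build G gen gen1.
HB.instance Definition _ := isInvClosed.Build G gen genV.

End Generated.

Definition cyclic (G : groupType) : Prop :=
  exists g : G, forall x : G, x \in gen [set g].

Definition normal (G : groupType) (N : groupClosed G) : Prop :=
  forall x y : G, x \in N -> x ^ y \in N.

Section SubgroupAsGroup.
Variables (G : groupType) (K : groupClosed G).

Record sub_group : Type := SubGroup
  { sub_group_val : G; _ : sub_group_val \in K }.

HB.instance Definition _ := [isSub for sub_group_val].
HB.instance Definition _ := [Choice of sub_group by <:].

Fact sub_group_closed : group_closed (fun x => x \in K).
Proof. by split; [exact: gpred1 | exact: gpredF]. Qed.

HB.instance Definition _ :=
  SubChoice_isSubGroup.Build G (fun x => x \in K) sub_group sub_group_closed.

Variable H : groupClosed G.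

(* H :&: K, as a subgroup of the group K *)
Definition restrict : {pred sub_group} := fun u => val u \in H.

Fact restrict1 : 1 \in restrict.
Proof. exact: gpred1. Qed.

Fact restrictM : mulg_closed restrict.
Proof. by move=> x y; exact: gpredM. Qed.

Fact restrictV : invg_closed restrict.
Proof. by move=> x; exact: gpredVr. Qed.

HB.instance Definition _ := isMulClosed.Build sub_group restrict restrictM.
HB.instance Definition _ := isMul1Closed.Build sub_group restrict restrict1.
HB.instance Definition _ := isInvClosed.Build sub_group restrict restrictV.

End SubgroupAsGroup.

Arguments restrict {G} K H.

Section QuotientGroup.
Variables (G : groupType) (N : groupClosed G) (nN : normal N).

Definition same_coset (x y : G) : bool := x^-1 * y \in N.

Fact same_coset_refl : reflexive same_coset.
Proof. by move=> x; rewrite /same_coset mulVg gpred1. Qed.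

Fact same_coset_sym : symmetric same_coset.
Proof. by move=> x y; rewrite /same_coset -gpredV invgM invgK. Qed.

Fact same_coset_trans : transitive same_coset.
Proof.
move=> y x z xy yz; rewrite /same_coset.
by rewrite -(mulgK y x^-1) -mulgA gpredM.
Qed.

Canonical same_coset_equiv :=
  EquivRel same_coset same_coset_refl same_coset_sym same_coset_trans.

(* The proof of normality occurs in the type so that the group instance below *)
(* can be inferred.                                                           *)
Definition quotient of normal N : Type := {eq_quot same_coset}.
Local Notation Q := (quotient nN).

HB.instance Definition _ := Choice.on Q.
HB.instance Definition _ := EqQuotient.on Q.

Fact eq_coset (x y : G) : (\pi_Q x == \pi_Q y) = (x^-1 * y \in N).
Proof. exact: eqmodE. Qed.

Fact repr_coset (x : G) : x^-1 * repr (\pi_Q x) \in N.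
Proof. by rewrite -eq_coset reprK. Qed.

Definition quotient_one : Q := \pi_Q 1.
Definition quotient_mul (a b : Q) : Q := \pi_Q (repr a * repr b).
Definition quotient_inv (a : Q) : Q := \pi_Q (repr a)^-1.

Fact pi_mul (x y : G) : quotient_mul (\pi_Q x) (\pi_Q y) = \pi_Q (x * y).
Proof.
apply/eqP; rewrite eq_sym eq_coset invgM.
set x' := repr _; set y' := repr _.
have -> : y^-1 * x^-1 * (x' * y') = (x^-1 * x') ^ y * (y^-1 * y').
  by rewrite /conjg !mulgA mulgK.
by rewrite gpredM ?repr_coset// nN ?repr_coset.
Qed.

Fact pi_inv (x : G) : quotient_inv (\pi_Q x) = \pi_Q x^-1.
Proof.
apply/eqP; rewrite eq_coset invgK; set x' := repr _.
have -> : x' * x^-1 = (x^-1 * x') ^ x^-1.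
  by rewrite /conjg invgK !mulgA mulgV mul1g.
by rewrite nN ?repr_coset.
Qed.

Fact quotient_mulA : associative quotient_mul.
Proof.
move=> a b c; rewrite -[a]reprK -[b]reprK -[c]reprK.
move: (repr a) (repr b) (repr c) => x y z.
rewrite (pi_mul y z) (pi_mul x (y * z)) (pi_mul x y) (pi_mul (x * y) z).
by rewrite mulgA.
Qed.

Fact quotient_mul1 : left_id quotient_one quotient_mul.
Proof. by move=> a; rewrite -[a]reprK pi_mul mul1g. Qed.

Fact quotient_mulr1 : right_id quotient_one quotient_mul.
Proof. by move=> a; rewrite -[a]reprK pi_mul mulg1. Qed.

Fact quotient_mulV : left_inverse quotient_one quotient_inv quotient_mul.
Proof. by move=> a; rewrite -[a]reprK pi_inv pi_mul mulVg. Qed.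

Fact quotient_mulrV : right_inverse quotient_one quotient_inv quotient_mul.
Proof. by move=> a; rewrite -[a]reprK pi_inv pi_mul mulgV. Qed.

HB.instance Definition _ := isGroup.Build Q
  quotient_mulA quotient_mul1 quotient_mulr1 quotient_mulV quotient_mulrV.

End QuotientGroup.

(* There is a series 1 = H 0 <| H 1 <| ... <| H n = G with cyclic factors;    *)
(* H i need not be normal in G, and H i for n < i is irrelevant.              *)
Definition polycyclic (G : groupType) : Prop :=
  exists (n : nat) (H : nat -> groupClosed G),
    [/\ H 0 =i pred1 1,
        H n =i predT
      & forall i, (i < n)%N ->
          {subset H i <= H i.+1} /\
          exists nH : normal (restrict (H i.+1) (H i) : groupClosed _),
            cyclic (quotient nH)].

Definition finite_order (G : groupType) (x : G) : Prop :=
  exists2 k : nat, (0 < k)%N & x ^+ k = 1.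

Definition torsion_free (G : groupType) : Prop :=
  forall x : G, finite_order x -> x = 1.

Definition Tor (G : groupType) : groupClosed G :=
  gen [set x : G | finite_order x].

Section TorNormal.
Variables (G : groupType) (y : G).

Let conj_Tor : {pred G} := fun x => x ^ y \in Tor G.

Let conj_Tor1 : 1 \in conj_Tor.
Proof. by rewrite -topredE /= /conj_Tor conj1g gpred1. Qed.

Let conj_TorM : mulg_closed conj_Tor.
Proof.
by move=> x z Tx Tz; rewrite -topredE /= /conj_Tor conjMg; exact: gpredM.
Qed.

Let conj_TorV : invg_closed conj_Tor.
Proof.
by move=> x Tx; rewrite -topredE /= /conj_Tor conjVg; exact: gpredVr.
Qed.

HB.instance Definition _ := isMulClosed.Build G conj_Tor conj_TorM.
HB.instance Definition _ := isMul1Closed.Build G conj_Tor conj_Tor1.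
HB.instance Definition _ := isInvClosed.Build G conj_Tor conj_TorV.

Fact Tor_conj x : x \in Tor G -> x ^ y \in Tor G.
Proof.
move=> /asboolP/(_ (conj_Tor : groupClosed G)); apply => a [k k_gt0 ak].
apply/asboolP => H; apply; exists k => //.
by rewrite -conjXg ak conj1g.
Qed.

End TorNormal.

Fact normal_Tor (G : groupType) : normal (Tor G).
Proof. by move=> x y; exact: Tor_conj. Qed.

Fixpoint torsion_quotient (G : groupType) (i : nat) : groupType :=
  if i is j.+1 then quotient (normal_Tor (G := torsion_quotient G j)) else G.

(* [None] stands for omega. *)
Definition TorLen (G : groupType) : option nat :=
  match pselect (exists i, `[< torsion_free (torsion_quotient G i) >]) with
  | left h => Some (ex_minn h)
  | right _ => None
  end.

(* Main.v *)
Require Import Defs.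
From HB Require Import structures.
From mathcomp Require Import all_boot generic_quotient.
From mathcomp Require Import boolp classical_sets.
From mathcomp Require Import ssralg ssrint.
From mathcomp Require Import ring zify.

Set Implicit Arguments.
Unset Strict Implicit.
Unset Printing Implicit Defensive.

Import GRing.Theory.

(** The proof builds a tower of torsion-free polycyclic groups F_n, each with a
    central homomorphism rho_n from the additive group of integers, such that
    G_n = F_n / rho_n(Z) has torsion length n.

    F_0 is Z itself with rho_0 the identity, so that G_0 is trivial.  Given
    (F, rho), the next group F' consists of the tuples (f, v, k) with f in F, v
    in Z^2 and k in Z, multiplied by

      (f, v, k) (g, w, l)
        = (f g rho(det(v, (-1)^k w)), v + (-1)^k w, k + l).

    In other words F' is the central product of F with a Heisenberg group whose
    centre is glued to rho(Z), extended by an infinite cyclic group <s> acting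
    as -1 on Z^2.  The new central subgroup rho'(Z) is generated by s^2.

    The point is that every power of (f, v, k) has first component f^m and a
    multiple of v as second component (which is m v when k = 0), because
    det(v, w) vanishes on proportional vectors ([ext_exp]).  Hence F' is
    torsion-free when F is, and a torsion element of G' = F' / rho'(Z) is
    represented by a tuple with f = 1.  So Tor(G') is
    contained in the image of K = {(rho(i), v, k)}.  Conversely s and all the
    (1, v, 1) square into rho'(Z), and they generate K: their products yield all
    the (1, v, 0), and then rho(Z) by multiplying (1, (i, 0), 0) and
    (1, (0, 1), 0).
    Therefore Tor(G') is the image of K and G' / Tor(G') = F / rho(Z)
    ([mem_Tor_presented], [presents_torsion_quotient]): each step up the tower
    adds exactly one to the torsion length.

    The relation G = F / rho(Z) is expressed by a surjection from F onto G with
    kernel rho(Z) ([presents]).  Such surjections compose with quotient maps, so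
    that the iterated torsion quotients of G_n are followed down the tower
    without transporting anything along isomorphisms
    ([tower_torsion_quotient]).

    Polycyclicity is proved for the F_n, by adding the three infinite cyclic
    factors one by one, and passes to the quotient G_n. *)

(** * Homomorphisms *)

Section Morphisms.
Local Open Scope group_scope.

Lemma morph_one (G H : groupType) (f : G -> H) :
  {morph f : x y / x * y} -> f 1 = 1.
Proof. by move=> fM; apply: (@mulgI _ (f 1)); rewrite -fM !mulg1. Qed.

Lemma morph_inv (G H : groupType) (f : G -> H) :
  {morph f : x y / x * y} -> {morph f : x / x^-1}.
Proof.
move=> fM x; apply: (@mulgI _ (f x)).
by rewrite -fM !mulgV morph_one.
Qed.

Lemma morph_exp (G H : groupType) (f : G -> H) m :
  {morph f : x y / x * y} -> {morph f : x / x ^+ m}.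
Proof.
move=> fM x; elim: m => [|m IH]; first by rewrite !expg0 morph_one.
by rewrite !expgS fM IH.
Qed.

Lemma morph_conj (G H : groupType) (f : G -> H) :
  {morph f : x y / x * y} -> {morph f : x y / x ^ y}.
Proof. by move=> fM x y; rewrite !conjgE !fM morph_inv. Qed.

Lemma pi_morph (G : groupType) (N : groupClosed G) (nN : normal N) :
  {morph (\pi_(quotient nN) : G -> quotient nN)%qT : x y / x * y}.
Proof. by move=> x y; rewrite -pi_mul. Qed.

Lemma pi_eq1 (G : groupType) (N : groupClosed G) (nN : normal N) (x : G) :
  (\pi_(quotient nN)%qT x = 1) <-> x \in N.
Proof.
rewrite -(morph_one (pi_morph nN)); split=> [/eqP|xN].
  by rewrite eq_coset mulg1 gpredV.
by apply/eqP; rewrite eq_coset mulg1 gpredV.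
Qed.

End Morphisms.

(** The integers as a multiplicative group: homomorphisms from Z can be written
    as plain functions on [int] and still obey the lemmas above, and Z itself is
    the bottom of the tower. *)
Definition intG : Type := int.
HB.instance Definition _ := Choice.on intG.
HB.instance Definition _ := isGroup.Build intG
  (@addrA int) (@add0r int) (@addr0 int) (@addNr int) (@addrN int).

Section OneParameter.
Local Open Scope group_scope.
Variables (G : groupType) (z : int -> G).
Hypothesis zD : forall a b, z (a + b)%R = z a * z b.

Lemma one_param0 : z 0%R = 1.
Proof. exact: (@morph_one intG G z zD). Qed.

Lemma one_paramN a : z (- a)%R = (z a)^-1.
Proof. exact: (@morph_inv intG G z zD). Qed.

Lemma one_param_gen a : z a \in gen [set z 1%R]%classic.
Proof.
have g1 : z 1%R \in gen [set z 1%R]%classic by apply/asboolP=> H; apply.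
have gn (n : nat) : z n%:Z%R \in gen [set z 1%R]%classic.
  elim: n => [|n IH]; first by rewrite one_param0 gpred1.
  by rewrite intS zD gpredM.
by case: a => n; rewrite ?NegzE ?one_paramN ?gpredV.
Qed.

End OneParameter.

(** * Generated subgroups *)

Section Generation.
Local Open Scope group_scope.

Record subgroup (G : groupType) (P : set G) : Prop := Subgroup {
  sub1 : P 1;
  subM : forall x y, P x -> P y -> P (x * y);
  subV : forall x, P x -> P x^-1 }.

Lemma gen_sub (G : groupType) (A P : set G) : subgroup P ->
  (forall a, A a -> P a) -> forall x, x \in gen A -> P x.
Proof.
move=> [P1 PM PV] AP x.
pose Q : {pred G} := fun x => `[< P x >].
have QM : mulg_closed Q.
  by move=> a b /asboolP Pa /asboolP Pb; apply/asboolP/PM.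
have Q1 : 1 \in Q by apply/asboolP.
have QV : invg_closed Q by move=> a /asboolP Pa; apply/asboolP/PV.
pose QC : groupClosed G := HB.pack Q
  (isMulClosed.Build G Q QM) (isMul1Closed.Build G Q Q1)
  (isInvClosed.Build G Q QV).
move=> /asboolP/(_ QC) h.
by apply/(@asboolP (P x))/h => a /AP Pa; apply/asboolP.
Qed.

Lemma mem_gen (G : groupType) (A : set G) x : A x -> x \in gen A.
Proof. by move=> Ax; apply/asboolP=> H; apply. Qed.

Lemma gen_subgroup (G : groupType) (P : set G) x : subgroup P ->
  x \in gen P <-> P x.
Proof. by move=> sP; split; [apply: gen_sub | apply: mem_gen]. Qed.

End Generation.

(** * Polycyclic subgroups *)

Section Polycyclic.
Local Open Scope group_scope.

(** Subgroups with a polycyclic series, each cyclic factor being given by a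
    homomorphism [z] from the integers that normalizes the smaller subgroup [K].
    Unlike a series of subgroups indexed by integers, this transports along
    homomorphisms by a plain induction, and it makes [L] a subgroup
    automatically. *)
Inductive polyc_sub (G : groupType) : set G -> Prop :=
| polyc_sub1 (L : set G) : (forall x, L x <-> x = 1) -> polyc_sub L
| polyc_subS (K L : set G) (z : int -> G) :
    polyc_sub K -> (forall a b, z (a + b)%R = z a * z b) ->
    (forall a x, K x -> K (x ^ z a)) ->
    (forall x, L x <-> exists a, exists2 h, K h & x = z a * h) -> polyc_sub L.

Lemma polyc_sub_subgroup (G : groupType) (L : set G) : polyc_sub L -> subgroup L.
Proof.
elim=> {L} [L L1|K L z _ [K1 KM KV] zD Kz LE].
  split; first exact/L1.
    by move=> x y /L1 -> /L1 ->; apply/L1; rewrite mulg1.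
  by move=> x /L1 ->; apply/L1; rewrite invg1.
split.
- by apply/LE; exists 0%R, 1; rewrite // one_param0 // mulg1.
- move=> _ _ /LE [a [h Kh ->]] /LE [b [k Kk ->]].
  apply/LE; exists (a + b)%R, (h ^ z b * k); first exact/KM/Kk/Kz.
  by rewrite zD conjgE !mulgA mulgK.
- move=> _ /LE [a [h Kh ->]]; apply/LE; exists (- a)%R, (h^-1 ^ z (- a)%R).
    exact/Kz/KV.
  by rewrite invgM conjgE one_paramN // invgK !mulgA mulVg mul1g.
Qed.

Lemma polyc_sub_image (G H : groupType) (f : G -> H) (L : set G) :
  {morph f : x y / x * y} -> polyc_sub L -> polyc_sub (f @` L)%classic.
Proof.
move=> fM; elim=> {L} [L L1|K L z _ pK zD Kz LE].
  apply: polyc_sub1 => y; split=> [[x /L1 -> <-]|->]; first exact: morph_one.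
  by exists 1; [apply/L1 | apply: morph_one].
apply: (polyc_subS (K := (f @` K)%classic) (z := f \o z)) => //.
- by move=> a b /=; rewrite zD fM.
- move=> a _ [x Kx <-]; exists (x ^ z a); first exact: Kz.
  exact: morph_conj.
- move=> y; split.
    by move=> [_ /LE [a [h Kh ->]] <-]; exists a, (f h); [exists h | rewrite fM].
  move=> [a [_ [h Kh <-] ->]]; exists (z a * h); last by rewrite fM.
  by apply/LE; exists a, h.
Qed.

Definition cyclic_step (G : groupType) (K L : groupClosed G) : Prop :=
  {subset K <= L} /\
  exists nK : normal (restrict L K : groupClosed _), cyclic (quotient nK).

(** The coset of [z 1] generates the quotient of [L] by [K]. *)
Lemma cyclic_step_gen (G : groupType) (K L : set G) (z : int -> G) :
  subgroup K -> subgroup L ->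
  (forall a b, z (a + b)%R = z a * z b) ->
  (forall a x, K x -> K (x ^ z a)) ->
  (forall x, L x <-> exists a, exists2 h, K h & x = z a * h) ->
  cyclic_step (gen K) (gen L).
Proof.
move=> sK sL zD Kz LE.
have KL x : K x -> L x.
  by move=> Kx; apply/LE; exists 0%R, x; rewrite // one_param0 // mul1g.
split=> [x /(gen_subgroup _ sK) /KL /(gen_subgroup _ sL) //|].
have nK : normal (restrict (gen L) (gen K) : groupClosed _).
  move=> u v; rewrite -!topredE /= /restrict.
  have -> : val (u ^ v) = val u ^ val v by [].
  move=> /(gen_subgroup _ sK) Ku; apply/(gen_subgroup _ sK).
  have /(gen_subgroup _ sL)/LE [a [h Kh ->]] := valP v.
  rewrite conjgM; move: (Kz a _ Ku); move: (_ ^ z a) => x Kx.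
  by rewrite conjgE; apply: subM => //; [apply: subV | apply: subM].
exists nK.
have Lz a : z a \in gen L.
  apply/(gen_subgroup _ sL)/LE; exists a, 1; first exact: sub1.
  by rewrite mulg1.
pose w a : quotient nK := (\pi_(quotient nK) (Defs.SubGroup (Lz a)))%qT.
have wD a b : w (a + b)%R = w a * w b.
  by rewrite /w -pi_morph; congr (\pi_(_) _)%qT; apply: val_inj; rewrite /= zD.
exists (w 1%R) => q; rewrite -[q]reprK; set u := repr q.
have /(gen_subgroup _ sL)/LE [a [h Kh uE]] := valP u.
suff -> : (\pi_(quotient nK) u)%qT = w a by apply: one_param_gen.
apply/eqP; rewrite eq_sym eq_coset -topredE /= /restrict /= uE mulKg.
exact/(gen_subgroup _ sK).
Qed.

Lemma polyc_sub_series (G : groupType) (L : set G) : polyc_sub L ->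
  exists (n : nat) (H : nat -> groupClosed G),
    [/\ H 0 =i pred1 1, H n = gen L
      & forall i, i < n -> cyclic_step (H i) (H i.+1)].
Proof.
elim=> {L} [L L1|K L z pK [n [H [H0 Hn Hi]]] zD Kz LE].
  have sL : subgroup L by apply/polyc_sub_subgroup/polyc_sub1.
  exists 0, (fun=> gen L : groupClosed G); split=> // x.
  rewrite inE; apply/idP/eqP; first by move/(gen_subgroup _ sL)/L1.
  by move=> ->; apply: gpred1.
have sK := polyc_sub_subgroup pK.
have sL : subgroup L by apply: polyc_sub_subgroup; apply: (polyc_subS pK).
exists n.+1, (fun i => if i <= n then H i else (gen L : groupClosed G)); split=> //.
  by rewrite ltnn.
move=> i; rewrite ltnS /= => le_in; rewrite le_in.
move: le_in; rewrite leq_eqVlt => /orP[/eqP ->|lt_in].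
  by rewrite ltnn Hn; apply: cyclic_step_gen.
by rewrite lt_in; apply: Hi.
Qed.

Lemma polyc_subT (G : groupType) : @polyc_sub G setT -> polycyclic G.
Proof.
move=> pG; have [n [H [H0 Hn Hi]]] := polyc_sub_series pG.
exists n, H; split=> // x; rewrite Hn.
by apply/(gen_subgroup _ (polyc_sub_subgroup pG)).
Qed.

End Polycyclic.

(** * The extension of a group with a central cyclic subgroup *)

Record centralZ := CentralZ {
  carrier :> groupType;
  rho : int -> carrier;
  rhoD : forall a b, rho (a + b)%R = (rho a * rho b)%g;
  rhoC : forall a x, commute (rho a) x }.

(** The action of the last coordinate of the extension on the plane Z^2. *)
Definition signz (k : int) : int := ((-1) ^ k)%R.

Arguments signz : simpl never.

Section Sign.
Local Open Scope ring_scope.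

Lemma signzD k l : signz (k + l) = signz k * signz l.
Proof. by rewrite /signz exprzDr. Qed.

Lemma signz_cases k : signz k = 1 \/ signz k = -1.
Proof.
have : signz k * signz k = 1.
  by rewrite -expr2 /signz exprnP exprz_exp mulrC -exprz_exp -exprnP sqrrN expr1n exp1rz.
by move/eqP; rewrite -expr2 sqrf_eq1 => /orP[] /eqP; [left | right].
Qed.

Lemma signz0 : signz 0 = 1. Proof. by []. Qed.

Lemma signz_double k : signz (k + k) = 1.
Proof. by rewrite signzD; case: (signz_cases k) => ->. Qed.

Lemma signzN k : signz (- k) = signz k.
Proof.
have := signzD k (- k); rewrite addrN signz0.
by case: (signz_cases k) => ->; case: (signz_cases (- k)) => ->.
Qed.
End Sign.

Section Extension.
Variable F : centralZ.
Local Notation rho := (@rho F).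
Local Open Scope group_scope.

Lemma rho_eq1 c : c = 0%R -> rho c = 1.
Proof. by move=> ->; apply: one_param0; apply: rhoD. Qed.

(** A tuple (f, (a, b, k)) stands for f times a Heisenberg element with
    coordinates (a, b), times the k-th power of the element s that acts as -1 on
    the plane. *)
Definition ext : Type := (F * (int * int * int))%type.
HB.instance Definition _ := Choice.on ext.

Definition ext_mul (x y : ext) : ext :=
  let: (f, (a, b, k)) := x in let: (g, (c, d, l)) := y in
  (f * g * rho (signz k * (a * d - b * c))%R,
   (a + signz k * c, b + signz k * d, k + l)%R).

Definition ext_one : ext := (1, (0, 0, 0)%R).

Definition ext_inv (x : ext) : ext :=
  let: (f, (a, b, k)) := x in
  (f^-1, (- (signz k * a), - (signz k * b), - k)%R).

Fact ext_mulA : associative ext_mul.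
Proof.
move=> [f [[a b] k]] [g [[c d] l]] [h [[p q] m]] /=.
congr (_, (_, _, _)); rewrite ?signzD; try by ring.
rewrite -!mulgA; congr (_ * (_ * _)).
rewrite [in RHS]mulgA (rhoC _ h) -!mulgA -!rhoD.
congr (_ * rho _); case: (signz_cases k) => ->; ring.
Qed.

Fact ext_mul1 : left_id ext_one ext_mul.
Proof.
move=> [f [[a b] k]] /=; rewrite signz0 mul1g.
rewrite rho_eq1 ?mulg1; last by ring.
by congr (_, (_, _, _)); ring.
Qed.

Fact ext_mulr1 : right_id ext_one ext_mul.
Proof.
move=> [f [[a b] k]] /=; rewrite mulg1.
rewrite rho_eq1 ?mulg1; last by ring.
by congr (_, (_, _, _)); ring.
Qed.

Fact ext_mulV : left_inverse ext_one ext_inv ext_mul.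
Proof.
move=> [f [[a b] k]] /=; rewrite signzN mulVg mul1g.
by rewrite rho_eq1; [congr (_, (_, _, _)); ring | ring].
Qed.

Fact ext_mulrV : right_inverse ext_one ext_inv ext_mul.
Proof.
move=> [f [[a b] k]] /=; rewrite mulgV mul1g.
rewrite rho_eq1; last by ring.
by congr (_, (_, _, _)); first [by ring | by case: (signz_cases k) => ->; ring].
Qed.

HB.instance Definition _ := isGroup.Build ext
  ext_mulA ext_mul1 ext_mulr1 ext_mulV ext_mulrV.

Lemma ext_mulE f a b k g c d l :
  ((f, (a, b, k)) : ext) * ((g, (c, d, l)) : ext) =
  (f * g * rho (signz k * (a * d - b * c))%R,
   (a + signz k * c, b + signz k * d, k + l)%R).
Proof. by []. Qed.

(** Squares of s act trivially on the plane, so they are central. *)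
Definition ext_rho (k : int) : ext := (1, (0, 0, k + k)%R).

Fact ext_rhoD a b : ext_rho (a + b)%R = ext_rho a * ext_rho b.
Proof.
rewrite ext_mulE rho_eq1 ?mulg1; last by ring.
by congr (_, (_, _, _)); ring.
Qed.

Fact ext_rhoC a x : commute (ext_rho a) x.
Proof.
case: x => f [[b c] k]; rewrite /commute !ext_mulE signz_double.
rewrite !rho_eq1; try ring.
by rewrite !mulg1 !mul1g; congr (_, (_, _, _)); ring.
Qed.

Definition extend : centralZ := CentralZ ext_rhoD ext_rhoC.
Definition incl (f : F) : ext := (f, (0, 0, 0)%R).

Lemma incl_morph : {morph incl : x y / x * y}.
Proof.
move=> f g; rewrite ext_mulE rho_eq1; last by ring.
by rewrite mulg1.
Qed.

(** The vectors occurring in the powers of (f, v, k) are all proportional to v,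
    so no power of [rho] enters the first component.  The factor [c] is m or the
    parity of m according to the parity of k. *)
Lemma ext_exp f a b k m : exists2 c : int, (k = 0 -> c = m%:Z)%R &
  ((f, (a, b, k)) : ext) ^+ m = (f ^+ m, (c * a, c * b, m%:Z * k)%R).
Proof.
elim: m => [|m [c ck IH]]; first by exists 0%R; rewrite ?mul0r.
exists (1 + signz k * c)%R; first by move=> k0; rewrite ck // k0 mul1r intS.
rewrite expgS IH ext_mulE expgS intS.
rewrite rho_eq1 ?mulg1; last by ring.
by congr (_, (_, _, _)); ring.
Qed.

Lemma extend_torsion_free : torsion_free F -> torsion_free ext.
Proof.
move=> tfF [f [[a b] k]] [m m_gt0 xm1].
have reg_m (c : int) : (m%:Z * c = 0 -> c = 0)%R.
  by move=> /eqP; rewrite mulf_eq0 => /orP[|/eqP //]; lia.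
have [c ck] := ext_exp f a b k m.
rewrite xm1 => -[/esym fm1 /esym a0 /esym b0 /esym /reg_m k0].
move: a0 b0; rewrite ck // k0 => /reg_m -> /reg_m ->.
by rewrite (tfF f) //; exists m.
Qed.

(** The coordinates a, b and k each contribute one infinite cyclic factor above
    the copy of [F]. *)
Lemma extend_polyc_sub : @polyc_sub F setT -> @polyc_sub ext setT.
Proof.
move=> pF; pose K0 : set ext := (incl @` setT)%classic.
have pK0 : polyc_sub K0 by apply: polyc_sub_image incl_morph pF.
pose K1 : set ext := fun x => x.2.1.2 = 0%R /\ x.2.2 = 0%R.
pose K2 : set ext := fun x => x.2.2 = 0%R.
have pK1 : polyc_sub K1.
  apply: (polyc_subS (z := fun a => (1, (a, 0, 0)%R) : ext) pK0).
  - move=> a b; rewrite ext_mulE rho_eq1 ?mulg1; last by ring.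
    by congr (_, (_, _, _)); ring.
  - move=> a _ [f _ <-]; exists f => //; rewrite conjgE.
    apply: (@mulgI _ ((1, (a, 0, 0)%R) : ext)); rewrite mulVKg !ext_mulE.
    rewrite !rho_eq1; try ring.
    by rewrite !mulg1 mul1g; congr (_, (_, _, _)); ring.
  - move=> [f [[a b] k]]; rewrite /K1 /=; split.
      move=> [-> ->]; exists a, (incl f); first by exists f.
      rewrite ext_mulE rho_eq1; last by ring.
      by rewrite mulg1 mul1g; congr (_, (_, _, _)); ring.
    by move=> [c [_ [g _ <-]]]; rewrite ext_mulE => -[_ _ -> ->]; split; ring.
have pK2 : polyc_sub K2.
  apply: (polyc_subS (z := fun b => (1, (0, b, 0)%R) : ext) pK1).
  - move=> a b; rewrite ext_mulE rho_eq1 ?mulg1; last by ring.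
    by congr (_, (_, _, _)); ring.
  - move=> b [f [[a c] k]] [/= -> ->]; rewrite conjgE.
    by split; rewrite /= ?signzN ?signz0; ring.
  - move=> [f [[a b] k]]; rewrite /K2 /=; split.
      (* The factor rho(ab) compensates the determinant of (0, b) and (a, 0). *)
      move=> ->; exists b, (f * rho (a * b)%R, (a, 0, 0)%R) => //.
      rewrite ext_mulE mul1g -mulgA -rhoD rho_eq1; last by rewrite signz0; ring.
      by rewrite mulg1; congr (_, (_, _, _)); rewrite ?signz0; ring.
    move=> [c [[g [[p q] l]] [/= _ ->]]].
    by rewrite ext_mulE => -[_ _ _ ->]; ring.
apply: (polyc_subS (z := fun k => (1, (0, 0, k)%R) : ext) pK2).
- move=> a b; rewrite ext_mulE rho_eq1 ?mulg1; last by ring.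
  by congr (_, (_, _, _)); ring.
- by move=> k [f [[a c] l]]; rewrite /K2 /= => ->; ring.
- move=> [f [[a b] k]]; split=> // _.
  (* Moving s^k to the left applies the sign to the vector; being an involution,
     it is its own inverse. *)
  exists k, (f, (signz k * a, signz k * b, 0)%R) => //.
  rewrite ext_mulE mul1g rho_eq1; last by ring.
  rewrite mulg1; congr (_, (_, _, _)); try ring.
    by case: (signz_cases k) => ->; ring.
  by case: (signz_cases k) => ->; ring.
Qed.

End Extension.

(** * Torsion of the central quotients *)

Section Presentations.
Local Open Scope group_scope.

(** [p] identifies [G] with the quotient of [F] by the image of [rho F]. *)
Definition presents (F : centralZ) (G : groupType) (p : F -> G) : Prop :=
  [/\ {morph p : x y / x * y}, forall g, exists x, p x = g
    & forall x, p x = 1 <-> exists k, x = rho F k].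

Variables (F : centralZ) (G : groupType) (p : extend F -> G).
Hypothesis tfF : torsion_free F.
Hypothesis pP : presents p.

Let pM : {morph p : x y / x * y}. Proof. by case: pP. Qed.
Let pK x : p x = 1 <-> exists k, x = ext_rho F k. Proof. by case: pP. Qed.

(** The image of s = (1, 0, 1) has order 2. *)
Lemma extend_not_torsion_free : ~ torsion_free G.
Proof.
pose s : extend F := (1, (0, 0, 1)%R) : ext F.
move=> /(_ (p s)) tf; have /pK [k [/eqP]] : p s = 1.
  apply: tf; exists 2 => //; rewrite expg2 -pM; apply/pK; exists 1%R.
  rewrite ext_mulE rho_eq1; last by ring.
  by rewrite !mulg1; congr (_, (_, _, _)); ring.
by lia.
Qed.

(** A torsion element lifts to a tuple with first component of finite order,
    hence equal to 1 in the torsion-free group [F].  Conversely every (1, v, 1)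
    and every power of s squares into the kernel of [p], and these tuples generate
    all tuples with first component in the image of [rho F]. *)
Lemma mem_Tor_presented x : p x \in Tor G <-> exists k, x.1 = rho F k.
Proof.
split.
  pose P : set G := fun g => exists2 y : ext F, p y = g & exists k, y.1 = rho F k.
  have sP : subgroup P.
    split.
    - exists 1; first exact: morph_one.
      by exists 0%R; rewrite rho_eq1.
    - move=> _ _ [[f [[a b] k]] <- [i /= ->]] [[g [[c d] l]] <- [j /= ->]].
      exists (((rho F i, (a, b, k)) : ext F) * ((rho F j, (c, d, l)) : ext F)).
        exact: pM.
      by rewrite ext_mulE /= -!rhoD; eexists.
    - move=> _ [[f [[a b] k]] <- [i /= ->]].
      exists ((rho F i, (a, b, k)) : ext F)^-1; first exact: (morph_inv pM).
      by exists (- i)%R; rewrite one_paramN //; apply: rhoD.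
  move=> /(gen_sub sP) [|y pyx [k yk]].
    move=> g [m m_gt0 gm1]; have [_ /(_ g) [y yg] _] := pP; exists y => //.
    move: gm1; rewrite -yg -(morph_exp m pM) => /pK [k].
    case: y yg => f [[a b] l] _; have [c _ ->] := ext_exp f a b l m.
    move=> -[fm1 _ _ _]; exists 0%R; rewrite rho_eq1 //.
    by apply: tfF; exists m.
  have /pK [i] : p (y^-1 * x) = 1 by rewrite pM (morph_inv pM) pyx mulVg.
  move=> /(congr1 (mul (y : ext F))); rewrite mulVKg => ->.
  case: y yk {pyx} => f [[a b] l] /= ->.
  by exists k; rewrite /= [X in _ * X]rho_eq1 ?mulg1; [ | ring].
pose e i a b k : extend F := (rho F i, (a, b, k)) : ext F.
have eM i a b k j c d l : e i a b k * e j c d l =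
    e (i + j + signz k * (a * d - b * c))%R (a + signz k * c)%R (b + signz k * d)%R
      (k + l)%R.
  by rewrite /e !rhoD.
have eR k : e 0%R 0%R 0%R (k + k)%R = ext_rho F k.
  by rewrite /e /ext_rho rho_eq1.
have tor_s k : p (e 0%R 0%R 0%R k) \in Tor G.
  apply: mem_gen; exists 2 => //; rewrite expg2 -pM; apply/pK; exists k.
  by rewrite eM -eR; congr e; ring.
have tor_odd a b : p (e 0%R a b 1%R) \in Tor G.
  apply: mem_gen; exists 2 => //; rewrite expg2 -pM; apply/pK; exists 1%R.
  by rewrite eM -eR; congr e; rewrite /signz; ring.
have tor_v a b : p (e 0%R a b 0%R) \in Tor G.
  have -> : e 0%R a b 0%R = e 0%R a b 1%R * e 0%R 0%R 0%R (-1)%R.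
    by rewrite eM; congr e; ring.
  by rewrite pM gpredM.
(* rho(i) is a quotient of (rho(i), (i, 1), 0) = (1, (i, 0), 0) (1, (0, 1), 0)
   by (1, (i, 1), 0), since the determinant of (i, 0) and (0, 1) is i. *)
have tor_r i : p (e i 0%R 0%R 0%R) \in Tor G.
  have eE : e i 0%R 0%R 0%R * e 0%R i 1%R 0%R =
      e 0%R i 0%R 0%R * e 0%R 0%R 1%R 0%R.
    by rewrite !eM signz0; congr e; ring.
  by rewrite -(gpredMr _ (tor_v i 1%R)) -pM eE pM gpredM.
case: x => f [[a b] k] [i /= ->].
have -> : (rho F i, (a, b, k)) =
    e i 0%R 0%R 0%R * e 0%R a b 0%R * e 0%R 0%R 0%R k :> ext F.
  by rewrite !eM addr0 signz0 -/(e i a b k); congr e; ring.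
by rewrite !pM !gpredM.
Qed.

(** The tuples (1, v, k) become trivial modulo torsion, and only the image of
    [rho F] becomes trivial in [F]. *)
Lemma presents_torsion_quotient :
  presents (fun f : F => (\pi_(quotient (normal_Tor (G := G))) (p (incl f)))%qT).
Proof.
have piM := pi_morph (normal_Tor (G := G)).
have qM := fun x y => etrans (congr1 _ (pM x y)) (piM _ _).
split=> [f g|q|f].
- by rewrite incl_morph qM.
- have [_ /(_ (repr q)) [[f [[a b] k]] px] _] := pP.
  exists f; rewrite -[q]reprK -px.
  have xE : ((f, (a, b, k)) : ext F) = incl f * ((1, (a, b, k)) : ext F).
    rewrite ext_mulE rho_eq1; last by ring.
    by rewrite !mulg1 signz0 !mul1r !add0r.
  rewrite xE qM.
  have /(pi_eq1 (normal_Tor (G := G))) -> : p ((1, (a, b, k)) : ext F) \in Tor G.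
    by apply/mem_Tor_presented; exists 0%R; rewrite rho_eq1.
  by rewrite mulg1.
- by split=> [/pi_eq1/mem_Tor_presented //|h]; apply/pi_eq1/mem_Tor_presented.
Qed.

End Presentations.

(** * The tower and its torsion length *)

Section Tower.

Definition tower0 : centralZ :=
  @CentralZ intG (@id int) (fun _ _ => erefl) (@addrC int).

Fixpoint tower (n : nat) : centralZ :=
  if n is m.+1 then extend (tower m) else tower0.

Local Open Scope group_scope.

Lemma tower0_exp (x : tower0) m : x ^+ m = (m%:Z * x)%R :> intG.
Proof.
elim: m => [|m IH]; first by rewrite mul0r.
by rewrite expgS intS mulrDl mul1r -IH.
Qed.

Lemma tower_torsion_free n : torsion_free (tower n).
Proof.
elim: n => [x [m m_gt0 xm1]|n IH]; last exact: extend_torsion_free.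
apply/eqP; have := tower0_exp x m; rewrite xm1 => /esym/eqP.
by rewrite mulf_eq0 => /orP[|//]; lia.
Qed.

Lemma tower_polyc_sub n : @polyc_sub (tower n) setT.
Proof.
elim: n => [|n IH]; last exact: extend_polyc_sub.
apply: (@polyc_subS tower0 [set 1]%classic _ id); first exact: polyc_sub1.
- by [].
- by move=> a x /= ->; rewrite conj1g.
- by move=> x; split=> // _; exists x, 1; rewrite ?mulg1.
Qed.

Lemma tower0_presents_torsion_free (G : groupType) (p : tower0 -> G) :
  presents p -> torsion_free G.
Proof.
by move=> [_ ps pK] g _; have [x <-] := ps g; apply/pK; exists x.
Qed.

Lemma tower_torsion_quotient (G : groupType) N (p : tower N -> G) i n :
  presents p -> N = (i + n)%N ->
  exists q : tower n -> torsion_quotient G i, presents q.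
Proof.
move=> pP; elim: i n => [|i IH] n NE; first by subst N; exists p.
have [|q qP] := IH n.+1; first by rewrite NE addSnnS.
eexists; exact: presents_torsion_quotient (@tower_torsion_free n) qP.
Qed.

Lemma TorLen_eq (G : groupType) n :
  (forall i, i < n -> ~ torsion_free (torsion_quotient G i)) ->
  torsion_free (torsion_quotient G n) -> TorLen G = Some n.
Proof.
move=> ltn_tf n_tf; rewrite /TorLen.
case: (pselect _) => [h|[]]; last by exists n; apply/asboolP.
case: (ex_minnP h) => m /asboolP m_tf /(_ n (asboolT n_tf)) le_mn.
congr Some; apply/eqP; rewrite eqn_leq le_mn leqNgt.
by apply/negP => /ltn_tf.
Qed.

Lemma tower_TorLen (G : groupType) n (p : tower n -> G) :
  presents p -> TorLen G = Some n.
Proof.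
move=> pP; apply: TorLen_eq => [i lt_in|].
  have [|q qP] := tower_torsion_quotient (i := i) (n := (n - i.+1).+1) pP.
    by rewrite addnS -addSn subnKC.
  exact: extend_not_torsion_free qP.
have [|q qP] := tower_torsion_quotient (i := n) (n := 0) pP; first by rewrite addn0.
exact: tower0_presents_torsion_free qP.
Qed.

Lemma presents_quotient (F : centralZ) :
  exists (G : groupType) (p : F -> G), presents p.
Proof.
pose R : set F := fun x => exists k, x = rho F k.
have sR : subgroup R.
  split; first by exists 0%R; rewrite rho_eq1.
    by move=> _ _ [a ->] [b ->]; exists (a + b)%R; rewrite rhoD.
  by move=> _ [a ->]; exists (- a)%R; rewrite one_paramN //; apply: rhoD.
have nR : normal (gen R : groupClosed F).
  move=> x y /(gen_subgroup _ sR) [a ->]; apply/(gen_subgroup _ sR).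
  by exists a; rewrite conjgE rhoC mulKg.
exists (quotient nR), (fun x => (\pi_(quotient nR) x)%qT).
split; first exact: pi_morph.
  by move=> q; exists (repr q); rewrite reprK.
move=> x; split=> [/(pi_eq1 nR)/(gen_subgroup _ sR) //|Rx].
by apply/(pi_eq1 nR)/(gen_subgroup _ sR).
Qed.

Lemma presents_polycyclic (F : centralZ) (G : groupType) (p : F -> G) :
  presents p -> @polyc_sub F setT -> polycyclic G.
Proof.
move=> [pM ps _] /(polyc_sub_image pM) pG; apply: polyc_subT.
suff -> : [set: G]%classic = (p @` setT)%classic by [].
by apply/seteqP; split=> // g _; have [x <-] := ps g; exists x.
Qed.

End Tower.

Theorem theorem2p14 (n : nat) (n_ge1 : 1 <= n) :
  exists G : groupType, polycyclic G /\ TorLen G = Some n.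
Proof.
have [G [p pP]] := presents_quotient (tower n).
exists G; split; last exact: tower_TorLen pP.
exact: presents_polycyclic pP (tower_polyc_sub n).
Qed.
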